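(* The Gauss map $T:[0,1)\to[0,1)$ is chaotic in the sense of Li-Yorke (with respect to the usual metric $|x-y|$ on $[0,1)$).
   Context: The Gauss map $T:[0,1)\to[0,1)$ is defined by $T(0)=0$ and $T(x)=\frac1x-\lfloor \frac1x\rfloor$ for $x\in(0,1)$. Let $(X,\rho)$ be a metric space and $f:X\to X$ a map. A pair $(x,y)\in X\times X$ is a scrambled pair for $f$ if $\limsup_{n\to\infty}\rho(f^n(x),f^n(y))>0$ and $\liminf_{n\to\infty}\rho(f^n(x),f^n(y))=0$. A subset $S\subseteq X$ containing at least two points is a scrambled set of $f$ if for all $x,y\in S$ with $x\ne y$, $(x,y)$ is a scrambled pair for $f$. If $f$ has an uncountable scrambled set, $f$ is called chaotic in the sense of Li-Yorke. *)

(* Defs.v *)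
From HB Require Import structures.
From mathcomp Require Import all_boot all_order all_algebra.
From mathcomp Require Import all_classical all_reals all_analysis.

Set Implicit Arguments.
Unset Strict Implicit.
Unset Printing Implicit Defensive.

Import Order.TTheory GRing.Theory Num.Theory.
Import numFieldNormedType.Exports.

Local Open Scope classical_set_scope.
Local Open Scope ring_scope.

Section li_yorke.
Context {R : realType} {X : metricType R}.
Implicit Types (f : X -> X) (S : set X).

Definition scrambled_pair f (x y : X) : Prop :=
  (0 < limn_esup (fun n => (mdist (iter n f x) (iter n f y))%:E))%E /\
  limn_einf (fun n => (mdist (iter n f x) (iter n f y))%:E) = 0%E.

Definition scrambled_set f S : Prop :=
  (exists x y, [/\ S x, S y & x <> y]) /\
  (forall x y, S x -> S y -> x <> y -> scrambled_pair f x y).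

Definition li_yorke_chaotic f : Prop :=
  exists S, ~ countable S /\ scrambled_set f S.

End li_yorke.

Definition co_unit_itv (R : realType) : Type := {x : R | 0 <= x < 1}.

HB.instance Definition _ (R : realType) := SubChoice.on (co_unit_itv R).

Section co_unit_itv_metric.
Context {R : realType}.
Implicit Types x y z : co_unit_itv R.

Definition co_unit_itv_dist x y : R := `|val x - val y|.

Lemma co_unit_itv_distxx x : co_unit_itv_dist x x = 0.
Proof. by rewrite /co_unit_itv_dist subrr normr0. Qed.

Lemma co_unit_itv_dist_positivity x y : co_unit_itv_dist x y = 0 -> x = y.
Proof. by move/normr0_eq0/eqP; rewrite subr_eq0 => /eqP/val_inj. Qed.

Lemma co_unit_itv_dist_sym x y : co_unit_itv_dist x y = co_unit_itv_dist y x.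
Proof. exact: distrC. Qed.

Lemma co_unit_itv_dist_triangle y x z :
  co_unit_itv_dist x z <= co_unit_itv_dist x y + co_unit_itv_dist y z.
Proof. exact: ler_distD. Qed.

HB.instance Definition _ := @isMetric.Build R (co_unit_itv R) co_unit_itv_dist
  co_unit_itv_distxx co_unit_itv_dist_positivity co_unit_itv_dist_sym
  co_unit_itv_dist_triangle.

Definition gauss_map_fun (x : R) : R :=
  if x == 0 then 0 else x^-1 - (Num.floor x^-1)%:~R.

Lemma gauss_map_fun_itv (x : R) : 0 <= gauss_map_fun x < 1.
Proof.
rewrite /gauss_map_fun; case: eqP => _; first by rewrite lexx ltr01.
by rewrite subr_ge0 ltrBlDl -intrD1 floor_itv.
Qed.

Definition gauss_map x : co_unit_itv R :=
  exist _ (gauss_map_fun (val x)) (gauss_map_fun_itv (val x)).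

End co_unit_itv_metric.

(* Main.v *)
(** Let [c] range over the binary sequences and let [x_c] be the continued
    fraction [[0; 1, b_0, 2, b_1, 3, b_2, ...]], where [b_m] is 3 or 1 according
    to the bit [c_(j m)] and [j] takes each value infinitely often. The even
    iterates satisfy [T^(2n) x_c < 1/(n+1)], so any two orbits come arbitrarily
    close. If [c] and [c'] differ then so do infinitely many of their digits
    [b_m], and at these times one odd iterate lies above 1/2 and the other one
    below 1/3. *)
Require Import Defs.
From mathcomp Require Import all_boot all_order all_algebra.
From mathcomp Require Import all_classical all_reals all_analysis.
From mathcomp Require Import zify lra.

Set Implicit Arguments.
Unset Strict Implicit.
Unset Printing Implicit Defensive.

Import Order.TTheory GRing.Theory Num.Theory.
Import numFieldNormedType.Exports.

Local Open Scope classical_set_scope.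
Local Open Scope ring_scope.

(** * Bounds on upper and lower limits from infinitely many terms *)

Section limn_esup_einf_frequently.
Context {R : realType}.
Implicit Types (u : (\bar R)^nat) (c : \bar R).

Lemma limn_esup_ge_frequently u c :
  (forall N, exists2 n, (N <= n)%N & (c <= u n)%E) -> (c <= limn_esup u)%E.
Proof.
(* The upper limit is an infimum, over neighbourhoods [V] of infinity, of suprema over [V]; each [V]
   contains a tail and so an index given by [cu]. *)
move=> cu; apply: le_ereal_inf_tmp => _ [V [N _ NV] <-].
have [n Nn cun] := cu N.
by apply: le_trans cun _; apply: ereal_sup_ubound; exists n => //; exact: NV.
Qed.

Lemma limn_einf_le_frequently u c :
  (forall N, exists2 n, (N <= n)%N & (u n <= c)%E) -> (limn_einf u <= c)%E.
Proof.
move=> uc; rewrite /limn_einf leeNl; apply: limn_esup_ge_frequently => N.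
by have [n Nn ucn] := uc N; exists n => //; rewrite leeN2.
Qed.

Lemma limn_einf_ge u c : (forall n, (c <= u n)%E) -> (c <= limn_einf u)%E.
Proof.
move=> cu; rewrite /limn_einf leeNr.
apply: (@le_trans _ _ (ereal_sup ((\- u)%E @` setT))).
  by apply: ereal_inf_lbound; exists setT => //; exact: filterT.
by apply: ge_ereal_sup => _ [n _ <-]; rewrite leeN2.
Qed.

End limn_esup_einf_frequently.

(** * Continued fractions read two digits at a time, and the Gauss map on them *)

Section continued_fraction.
Context {R : realType}.
Implicit Types (a b : nat -> nat) (y z : R) (k n : nat).

(* The digits are [k.+1] and [l.+1], which keeps them positive. *)
Definition two_digits k l y : R := (k.+1%:R + (l.+1%:R + y)^-1)^-1.

Lemma two_digits_itv k l y : 0 <= y -> 0 < two_digits k l y < 1.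
Proof.
move=> y0; have ly : 0 < l.+1%:R + y by rewrite ltr_pwDl.
have iy : 0 < (l.+1%:R + y)^-1 by rewrite invr_gt0.
have ky : 1 < k.+1%:R + (l.+1%:R + y)^-1 by rewrite -natr1; have := ler0n R k; lra.
by rewrite /two_digits invr_gt0 invf_lt1 ?ky ?(lt_trans ltr01 ky).
Qed.

(** Each of the two inversions reverses the order, so their composite preserves it; this is the gain
    from grouping digits in pairs. *)
Lemma two_digits_le k l y z : 0 <= y -> y <= z ->
  two_digits k l y <= two_digits k l z.
Proof.
move=> y0 yz; have z0 := le_trans y0 yz.
have ly : 0 < l.+1%:R + y by rewrite ltr_pwDl.
have lz : 0 < l.+1%:R + z by rewrite ltr_pwDl.
rewrite /two_digits lef_pV2 ?posrE ?addr_gt0 ?invr_gt0//.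
by rewrite lerD2l lef_pV2 ?posrE// lerD2l.
Qed.

(* Only the convergents of even order are used: they are nondecreasing. *)
Fixpoint even_convergent a b n : R :=
  if n is m.+1 then
    two_digits (a 0%N) (b 0%N) (even_convergent (a \o S) (b \o S) m)
  else 0.

Lemma even_convergent_itv a b n : 0 <= even_convergent a b n < 1.
Proof.
elim: n a b => [|n IHn] a b /=; first by rewrite lexx ltr01.
have /andP[y0 _] := IHn (a \o S) (b \o S).
by have /andP[/ltW-> ->] := two_digits_itv (a 0%N) (b 0%N) y0.
Qed.

Lemma even_convergent_nondecreasing a b :
  {homo even_convergent a b : n m / (n <= m)%N >-> n <= m}.
Proof.
apply: homo_leq => //; first exact: le_trans.
move=> n; elim: n a b => [|n IHn] a b.
  by have /andP[] := even_convergent_itv a b 1.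
by apply: two_digits_le; [have /andP[] := even_convergent_itv (a \o S) (b \o S) n
                         |exact: IHn].
Qed.

Definition cfrac a b : R := limn (even_convergent a b).

Lemma is_cvg_even_convergent a b : cvgn (even_convergent a b).
Proof.
apply: nondecreasing_is_cvgn; first exact: even_convergent_nondecreasing.
by exists 1 => _ [n _ <-]; have /andP[_ /ltW] := even_convergent_itv a b n.
Qed.

Lemma cfrac_ge0 a b : 0 <= cfrac a b.
Proof.
have nd := @even_convergent_nondecreasing a b.
exact: (nondecreasing_cvgn_le nd (@is_cvg_even_convergent a b) 0%N).
Qed.

Lemma cfrac_unfold a b :
  cfrac a b = two_digits (a 0%N) (b 0%N) (cfrac (a \o S) (b \o S)).
Proof.
(* The shifted convergents are [two_digits] of the convergents of the tail, so continuity at the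
   limit [y] suffices; both denominators are positive there. *)
apply: cvg_lim => //; rewrite -cvg_shiftS /=.
set y := cfrac _ _; have y0 : 0 <= y := cfrac_ge0 _ _.
have by0 : 0 < (b 0%N).+1%:R + y by rewrite ltr_pwDl.
apply: cvgV; first by rewrite gt_eqF// addr_gt0// invr_gt0.
apply: cvgD; first exact: cvg_cst.
apply: cvgV; first by rewrite gt_eqF.
by apply: cvgD; [exact: cvg_cst|exact: is_cvg_even_convergent].
Qed.

Lemma cfrac_itv a b : 0 < cfrac a b < 1.
Proof. by rewrite cfrac_unfold two_digits_itv// cfrac_ge0. Qed.

Lemma cfrac_co_itv a b : 0 <= cfrac a b < 1.
Proof. by have /andP[/ltW-> ->] := cfrac_itv a b. Qed.

Definition cfrac_pt a b : co_unit_itv R :=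
  exist _ (cfrac a b) (cfrac_co_itv a b).

Lemma gauss_map_funV k y : 0 <= y < 1 -> gauss_map_fun (k.+1%:R + y)^-1 = y.
Proof.
move=> /andP[y0 y1]; have ky : 0 < k.+1%:R + y by rewrite ltr_pwDl.
rewrite /gauss_map_fun invr_eq0 gt_eqF// invrK (@floor_def _ _ k.+1%:Z).
  by rewrite -pmulrn addrAC subrr add0r.
by rewrite intrD -pmulrn lerDl y0 ltrD2l.
Qed.

Lemma gauss_map_cfrac a b :
  gauss_map_fun (cfrac a b) = ((b 0%N).+1%:R + cfrac (a \o S) (b \o S))^-1.
Proof.
rewrite cfrac_unfold gauss_map_funV//.
(* The digit may be 1, so strict positivity of the tail is what keeps the reciprocal below 1. *)
have /andP[y0 y1] := cfrac_itv (a \o S) (b \o S).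
rewrite invr_ge0 invf_lt1; last by rewrite addr_gt0.
by rewrite -natr1; have := ler0n R (b 0%N); lra.
Qed.

(** Each application of the Gauss map strips one digit, so two applications strip a pair and stay
    within the family [cfrac_pt]. *)
Lemma gauss_map2_cfrac a b :
  gauss_map (gauss_map (cfrac_pt a b)) = cfrac_pt (a \o S) (b \o S).
Proof.
apply: val_inj; rewrite /= gauss_map_cfrac gauss_map_funV//.
exact: cfrac_co_itv.
Qed.

Lemma iter_gauss_cfrac n a b :
  iter n.*2 gauss_map (cfrac_pt a b) =
  cfrac_pt (fun k => a (n + k)%N) (fun k => b (n + k)%N).
Proof.
elim: n => [//|n IHn]; rewrite doubleS !iterS IHn gauss_map2_cfrac.
by congr cfrac_pt; apply/funext => k /=; rewrite addnS.
Qed.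

Lemma cfrac_lt a b : cfrac a b < (a 0%N).+1%:R^-1.
Proof.
have y0 := cfrac_ge0 (a \o S) (b \o S).
have by0 : 0 < (b 0%N).+1%:R + cfrac (a \o S) (b \o S) by rewrite ltr_pwDl.
by rewrite cfrac_unfold ltf_pV2 ?posrE ?ltrDl ?addr_gt0 ?invr_gt0.
Qed.

End continued_fraction.

(** * The points coded by binary sequences *)

Section scrambled_family.
Context {R : realType}.
Implicit Types c d : nat -> bool.

(* [logn 2 n.+1] takes every value for infinitely many [n]. *)
Definition bit_digit c n : nat := if c (logn 2 n.+1) then 2 else 0.

Definition coded_pt c : co_unit_itv R := cfrac_pt id (bit_digit c).

Lemma frequently_logn2 j N : exists2 n, (N <= n)%N & logn 2 n.+1 = j.
Proof.
have pos : (0 < 2 ^ j * 3 ^ N)%N by rewrite muln_gt0 !expn_gt0.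
(* The power of 3 leaves the 2-adic valuation equal to [j] and pushes the index beyond [N], since
   [N < 3 ^ N]. *)
exists (2 ^ j * 3 ^ N).-1; rewrite ?prednK//.
  rewrite -ltnS prednK//; apply: leq_trans (ltn_expl N (isT : 1 < 3)%N) _.
  by rewrite leq_pmull// expn_gt0.
by rewrite lognM ?expn_gt0// pfactorK// lognX (_ : logn 2 3 = 0)%N// muln0 addn0.
Qed.

Lemma coded_pt_even c n : val (iter n.*2 gauss_map (coded_pt c)) < n.+1%:R^-1.
Proof.
rewrite iter_gauss_cfrac; apply: lt_le_trans (cfrac_lt _ _) _.
by rewrite /= addn0.
Qed.

Lemma coded_pt_odd c n : exists2 y : R, 0 < y < 1 &
  val (iter n.*2.+1 gauss_map (coded_pt c)) = ((bit_digit c n).+1%:R + y)^-1.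
Proof.
rewrite iterS iter_gauss_cfrac /= gauss_map_cfrac addn0.
by exists (cfrac (addn n \o S) ((fun k => bit_digit c (n + k)%N) \o S));
  first exact: cfrac_itv.
Qed.

Lemma coded_pt_close c d n :
  mdist (iter n.*2 gauss_map (coded_pt c)) (iter n.*2 gauss_map (coded_pt d))
    <= n.+1%:R^-1 :> R.
Proof.
have dist_le (x y e : R) : 0 <= x -> 0 <= y -> x < e -> y < e -> `|x - y| <= e.
  by move=> *; rewrite ler_norml; apply/andP; split; lra.
have /andP[x0 _] := valP (iter n.*2 gauss_map (coded_pt c)).
have /andP[y0 _] := valP (iter n.*2 gauss_map (coded_pt d)).
exact: (dist_le _ _ _ x0 y0 (coded_pt_even c n) (coded_pt_even d n)).
Qed.

Lemma coded_pt_far c d n : c (logn 2 n.+1) != d (logn 2 n.+1) ->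
  6^-1 <= mdist (iter n.*2.+1 gauss_map (coded_pt c))
                (iter n.*2.+1 gauss_map (coded_pt d)) :> R.
Proof.
wlog cn : c d / c (logn 2 n.+1) => [hwlog cd|].
  have [/hwlog|cn] := boolP (c (logn 2 n.+1)); first exact.
  by rewrite metric_sym; apply: hwlog; move: cd cn; do 2 case: (_ (logn _ _)).
rewrite cn; case dn : (d (logn 2 n.+1)) => // _.
rewrite [mdist _ _]/(co_unit_itv_dist _ _) /co_unit_itv_dist.
have [y /andP[y0 y1] ->] := coded_pt_odd c n.
have [z /andP[z0 z1] ->] := coded_pt_odd d n.
rewrite /bit_digit cn dn.
(* The constant [6^-1] is the gap between 1/2 and 1/3. *)
have y3 : (3 + y)^-1 <= 3^-1 by rewrite lef_pV2 ?posrE; lra.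
have z2 : 2^-1 <= (1 + z)^-1 by rewrite lef_pV2 ?posrE; lra.
by rewrite distrC ler_normr; apply/orP; left; lra.
Qed.

Lemma coded_pt_frequently_far c d : c <> d -> forall N, exists2 n, (N <= n)%N &
  6^-1 <= mdist (iter n gauss_map (coded_pt c)) (iter n gauss_map (coded_pt d)) :> R.
Proof.
move=> cd N; have [j cdj] : exists j, c j != d j.
  by apply: contra_notP cd => /forallNP h; apply/funext => j; apply/eqP/negPn/negP/h.
have [n Nn jn] := frequently_logn2 j N.
by exists n.*2.+1; [lia|apply: coded_pt_far; rewrite jn].
Qed.

Lemma coded_pt_inj : injective coded_pt.
Proof.
move=> c d e; apply: contrapT => /coded_pt_frequently_far/(_ 0%N)[n _].
by rewrite {}e mdistxx; lra.
Qed.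

Lemma coded_pt_scrambled c d : c <> d ->
  scrambled_pair (@gauss_map R) (coded_pt c) (coded_pt d).
Proof.
move=> cd; split.
  apply: (@lt_le_trans _ _ (6^-1)%:E); first by rewrite lte_fin.
  apply: limn_esup_ge_frequently => N.
  by have [n Nn far] := coded_pt_frequently_far cd N; exists n; rewrite ?lee_fin.
apply/eqP; rewrite eq_le; apply/andP; split; last first.
  by apply: limn_einf_ge => n; rewrite lee_fin mdist_ge0.
apply/lee_addgt0Pr => e e0; rewrite add0e.
apply: limn_einf_le_frequently => N.
(* This choice makes [n.+1] exceed [e^-1], so the bound [n.+1%:R^-1] on the distance falls below
   [e]. *)
pose n := maxn N (Num.truncn e^-1).
exists n.*2; first by rewrite /n; lia.
rewrite lee_fin; apply: le_trans (coded_pt_close c d n) _.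
rewrite invf_ple ?posrE//; apply: ltW; apply: lt_le_trans (truncnS_gt _) _.
by rewrite ler_nat ltnS leq_maxr.
Qed.

End scrambled_family.

(** Cantor's diagonal argument: [D] differs at [n] from the sequence with code [n], if there is one.
    At the code of [D] itself, injectivity forces that sequence to be [D], a contradiction. *)
Lemma no_injection_bool_seq_nat (g : (nat -> bool) -> nat) : ~ injective g.
Proof.
move=> g_inj; pose D n := `[< exists2 c, g c = n & ~~ c n >].
have [Dt|Df] := boolP (D (g D)).
  by have /asboolP[c /g_inj ->] := Dt; rewrite Dt.
by move/negP: (Df); apply; apply/asboolP; exists D.
Qed.

Theorem corollary1p4 (R : realType) : li_yorke_chaotic (@gauss_map R).
Proof.
exists (range coded_pt); split.
  (* An injection of the range into the naturals would, composed with the injective [coded_pt],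
     inject all binary sequences. *)
  move=> /countable_injP[g g_inj].
  apply: (@no_injection_bool_seq_nat (g \o coded_pt)) => c d /= gcd.
  by apply/coded_pt_inj/g_inj => //; rewrite inE; eexists.
split; last first.
  by move=> _ _ [c _ <-] [d _ <-] cd; apply: coded_pt_scrambled => e; apply: cd; rewrite e.
exists (coded_pt (fun=> true)), (coded_pt (fun=> false)); split; [by eexists..|].
by move=> /coded_pt_inj/(congr1 (@^~ 0%N)).
Qed.
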